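(* Let $K$ be an algebraically closed field and let $Q=(Q_0,Q_1)$ be a connected quiver such that, for every finite subset $P_0'\subseteq Q_0$, the closure $\overline{P_0'}^Q$ of $P_0'$ under $Q$ is a finite acyclic quiver. Then for every finite dimensional $K$-linear representation $\mathcal X$ of $Q$: if $\mathrm{Ext}^n_{KQ}(G(\mathcal X),KQ)=0$ for all $n\geq 1$, then $G(\mathcal X)$ is a projective $KQ$-module.
   Context: A quiver $Q=(Q_0,Q_1)$ is a directed graph (possibly infinite) with vertex set $Q_0$, arrow set $Q_1$, and each arrow $a$ has source $s(a)$ and target $t(a)$. A path is a finite sequence of arrows $a_0a_1\cdots a_n$ with $t(a_i)=s(a_{i+1})$; for each vertex $v$ there is a trivial path $e_v$ of length $0$. $Q$ is acyclic if it has no nontrivial path with equal source and target; connected if its underlying undirected graph is connected; finite if $Q_0,Q_1$ are finite. The path algebra $KQ$ is the $K$-vector space with basis all paths, with product of two paths equal to their concatenation if the target of the first equals the source of the second and $0$ otherwise (extended bilinearly); if $Q_0$ is infinite, $KQ$ has no identity. Modules are right modules; a $KQ$-module $P$ is projective if every epimorphism of $KQ$-modules onto $P$ splits (equivalently, $\mathrm{Hom}_{KQ}(P,-)$ is exact). A $K$-linear representation $\mathcal X$ of $Q$ assigns a $K$-vector space $\mathcal X_v$ to each $v\in Q_0$ and a $K$-linear map $\mathcal X_a:\mathcal X_{s(a)}\to\mathcal X_{t(a)}$ to each $a\in Q_1$; it is finite dimensional if each $\mathcal X_v$ is finite dimensional. $G(\mathcal X)$ is the $KQ$-module with underlying space $\bigoplus_{v\in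 Q_0}\mathcal X_v$, where for $m=\sum_v x_v$ (with $x_v\in\mathcal X_v$, almost all zero), $m e_w:=x_w$ and $m a:=\mathcal X_a(m e_{s(a)})$, extended by distributivity. For $P_0'\subseteq Q_0$, the closure $\overline{P_0'}^Q$ is the subquiver whose vertices are all $v\in Q_0$ reachable by a path in $Q$ from some member of $P_0'$ (including members of $P_0'$ via trivial paths), and whose arrows are all $a\in Q_1$ whose source is such a vertex. *)

(* Defs.v *)
From HB Require Import structures.
From mathcomp Require Import all_boot all_order all_algebra.
From mathcomp Require Import boolp.
From mathcomp Require Import finmap.
From mathcomp.multinomials Require Import monalg.
From Stdlib Require Import Relations.
From Stdlib Require List.

Set Implicit Arguments.
Unset Strict Implicit.
Unset Printing Implicit Defensive.

Import GRing.Theory.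
Local Open Scope ring_scope.

Record quiver := Quiver {
  Q0 : Type;
  Q1 : Type;
  qs : Q1 -> Q0;
  qt : Q1 -> Q0 }.

(* A path a_0 a_1 ... a_n with t(a_i) = s(a_{i+1}), together with its
   starting vertex; with no arrows it is the trivial path e_v.        *)
Fixpoint composable (Q : quiver) (v : Q0 Q) (s : seq (Q1 Q)) : Prop :=
  match s with
  | [::] => True
  | a :: s' => qs a = v /\ composable (qt a) s'
  end.

Record path (Q : quiver) := Path {
  pstart : Q0 Q;
  parrows : seq (Q1 Q);
  pvalid : composable pstart parrows }.

Definition pend (Q : quiver) (p : path Q) : Q0 Q :=
  last (pstart p) (map (@qt Q) (parrows p)).

HB.instance Definition _ (Q : quiver) := gen_eqMixin (path Q).
HB.instance Definition _ (Q : quiver) := gen_choiceMixin (path Q).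

Definition triv_path (Q : quiver) (v : Q0 Q) : path Q := @Path Q v [::] I.

Lemma composable_cat (Q : quiver) (v : Q0 Q) (s1 s2 : seq (Q1 Q)) :
  composable v s1 -> composable (last v (map (@qt Q) s1)) s2 ->
  composable v (s1 ++ s2).
Proof.
elim: s1 v => [|a s1 IH] v //= [-> H1] H2; split => //; exact: IH.
Qed.

Lemma concat_valid (Q : quiver) (p q : path Q) :
  pend p = pstart q -> composable (pstart p) (parrows p ++ parrows q).
Proof.
move=> e; apply: composable_cat; first exact: pvalid.
rewrite -/(pend p) e; exact: pvalid.
Qed.

Definition connected (Q : quiver) : Prop :=
  forall u v : Q0 Q,
    clos_refl_sym_trans (Q0 Q) (fun x y => exists a : Q1 Q, qs a = x /\ qt a = y) u v.

Definition reachable (Q : quiver) (S : seq (Q0 Q)) (v : Q0 Q) : Prop :=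
  exists p : path Q, List.In (pstart p) S /\ pend p = v.

Lemma reachable_tgt (Q : quiver) (S : seq (Q0 Q)) (a : Q1 Q) :
  reachable S (qs a) -> reachable S (qt a).
Proof.
case=> p [Hin He].
have Hv : composable (pstart p) (parrows p ++ [:: a]).
  apply: composable_cat; first exact: pvalid.
  by rewrite -/(pend p) He /=.
exists (Path Hv); split => //.
by rewrite /pend /= map_cat last_cat.
Qed.

Definition quiver_closure (Q : quiver) (S : seq (Q0 Q)) : quiver :=
  @Quiver {v : Q0 Q | reachable S v} {a : Q1 Q | reachable S (qs a)}
    (fun a => exist _ (qs (proj1_sig a)) (proj2_sig a))
    (fun a => exist _ (qt (proj1_sig a)) (reachable_tgt (proj2_sig a))).

Definition finite_quiver (Q : quiver) : Prop :=
  (exists s : seq (Q0 Q), forall v, List.In v s) /\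
  (exists s : seq (Q1 Q), forall a, List.In a s).

Definition acyclic (Q : quiver) : Prop :=
  forall p : path Q, parrows p <> [::] -> pstart p <> pend p.

Section PathAlgebra.
Variables (K : fieldType) (Q : quiver).

Definition KQ := {malg K[path Q]}.

Definition idem (v : Q0 Q) : KQ := << triv_path v >>.

Definition pmul (p q : path Q) : KQ :=
  match pselect (pend p = pstart q) with
  | left e => << Path (concat_valid e) >>
  | right _ => 0
  end.

Definition KQmul (x y : KQ) : KQ :=
  \sum_(p <- msupp x) \sum_(q <- msupp y) (x@_p * y@_q) *: pmul p q.

Record KQmodule := KQModule {
  mcar : lmodType K;
  mact : mcar -> KQ -> mcar }.

(* module axioms: bilinear, associative, unitary (M = M KQ) *)
Definition is_module (M : KQmodule) : Prop :=
  [/\ (forall (m1 m2 : mcar M) (x : KQ), mact (m1 + m2) x = mact m1 x + mact m2 x),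
      (forall (m : mcar M) (x y : KQ), mact m (x + y) = mact m x + mact m y),
      (forall (c : K) (m : mcar M) (x : KQ), mact (c *: m) x = c *: mact m x),
      (forall (c : K) (m : mcar M) (x : KQ), mact m (c *: x) = c *: mact m x) &
      ((forall (m : mcar M) (x y : KQ), mact (mact m x) y = mact m (KQmul x y)) /\
       (forall m : mcar M, exists s : seq (Q0 Q), m = \sum_(v <- s) mact m (idem v)))].

Definition is_hom (M N : KQmodule) (f : mcar M -> mcar N) : Prop :=
  [/\ (forall m1 m2 : mcar M, f (m1 + m2) = f m1 + f m2),
      (forall (c : K) (m : mcar M), f (c *: m) = c *: f m) &
      (forall (m : mcar M) (x : KQ), f (mact m x) = mact (f m) x)].

Definition projective (P : KQmodule) : Prop :=
  forall (N : KQmodule), is_module N ->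
  forall f : mcar N -> mcar P, is_hom f -> (forall y, exists z, f z = y) ->
  exists g : mcar P -> mcar N, is_hom g /\ (forall y, f (g y) = y).

Record projres (M : KQmodule) := ProjRes {
  pr_mod : nat -> KQmodule;
  pr_d : forall n, mcar (pr_mod n.+1) -> mcar (pr_mod n);
  pr_eps : mcar (pr_mod 0) -> mcar M }.

Definition is_projres (M : KQmodule) (R : projres M) : Prop :=
  [/\ (forall n, is_module (pr_mod R n) /\ projective (pr_mod R n)),
      (forall n, is_hom (@pr_d M R n)),
      is_hom (@pr_eps M R),
      (forall y, exists z, @pr_eps M R z = y) &
      ((forall y, @pr_eps M R y = 0 <-> exists z, @pr_d M R 0 z = y) /\
       (forall n y, @pr_d M R n y = 0 <-> exists z, @pr_d M R n.+1 z = y))].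

Definition Ext_zero_wrt (M N : KQmodule) (R : projres M) (n : nat) : Prop :=
  forall f : mcar (pr_mod R n) -> mcar N, is_hom f ->
    (forall z, f (@pr_d M R n z) = 0) ->
    match n return (mcar (pr_mod R n) -> mcar N) -> Prop with
    | 0 => fun f => forall y, f y = 0
    | m.+1 => fun f => exists g : mcar (pr_mod R m) -> mcar N,
                 is_hom g /\ forall y, f y = g (@pr_d M R m y)
    end f.

Definition Ext_zero (M N : KQmodule) (n : nat) : Prop :=
  forall R : projres M, is_projres R -> Ext_zero_wrt N R n.

Definition KQreg : KQmodule := @KQModule KQ KQmul.

Record rep := Rep {
  rsp : Q0 Q -> vectType K;
  rmap : forall a : Q1 Q, {linear rsp (qs a) -> rsp (qt a)} }.

Variable X : rep.

Definition finsupp_fun (f : forall v, rsp X v) : Prop :=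
  exists s : seq (Q0 Q), forall v, ~ List.In v s -> f v = 0.

Record dsum := DSum { dfun : forall v, rsp X v; dfin : finsupp_fun dfun }.

HB.instance Definition _ := gen_eqMixin dsum.
HB.instance Definition _ := gen_choiceMixin dsum.

Lemma dsum_eq (x y : dsum) : (forall v, dfun x v = dfun y v) -> x = y.
Proof.
case: x y => [f Hf] [g Hg] /= e.
have efg : f = g by apply: functional_extensionality_dep.
by subst g; rewrite (Prop_irrelevance Hf Hg).
Qed.

Lemma fin0 : finsupp_fun (fun v => 0).
Proof. by exists [::]. Qed.
Lemma finN (x : dsum) : finsupp_fun (fun v => - dfun x v).
Proof. by case: (dfin x) => s Hs; exists s => v /Hs ->; rewrite oppr0. Qed.
Lemma finD (x y : dsum) : finsupp_fun (fun v => dfun x v + dfun y v).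
Proof.
case: (dfin x) => s Hs; case: (dfin y) => t Ht; exists (s ++ t) => v Hv.
rewrite Hs ?Ht ?addr0 // => H; apply: Hv; apply: List.in_or_app; tauto.
Qed.
Lemma finZ (c : K) (x : dsum) : finsupp_fun (fun v => c *: dfun x v).
Proof. by case: (dfin x) => s Hs; exists s => v /Hs ->; rewrite scaler0. Qed.

Definition dzero : dsum := DSum fin0.
Definition dopp (x : dsum) : dsum := DSum (finN x).
Definition dadd (x y : dsum) : dsum := DSum (finD x y).
Definition dscale (c : K) (x : dsum) : dsum := DSum (finZ c x).

Lemma daddA : associative dadd.
Proof. by move=> x y z; apply: dsum_eq => v /=; rewrite addrA. Qed.
Lemma daddC : commutative dadd.
Proof. by move=> x y; apply: dsum_eq => v /=; rewrite addrC. Qed.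
Lemma dadd0 : left_id dzero dadd.
Proof. by move=> x; apply: dsum_eq => v /=; rewrite add0r. Qed.
Lemma daddN : left_inverse dzero dopp dadd.
Proof. by move=> x; apply: dsum_eq => v /=; rewrite addNr. Qed.

HB.instance Definition _ := GRing.isZmodule.Build dsum daddA daddC dadd0 daddN.

Lemma dscaleA (a b : K) (x : dsum) : dscale a (dscale b x) = dscale (a * b) x.
Proof. by apply: dsum_eq => v /=; rewrite scalerA. Qed.
Lemma dscale1 : left_id 1 dscale.
Proof. by move=> x; apply: dsum_eq => v /=; rewrite scale1r. Qed.
Lemma dscaleDr : right_distributive dscale +%R.
Proof. by move=> a x y; apply: dsum_eq => v /=; rewrite scalerDr. Qed.
Lemma dscaleDl (x : dsum) : {morph dscale^~ x : a b / a + b}.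
Proof. by move=> a b; apply: dsum_eq => v /=; rewrite scalerDl. Qed.

HB.instance Definition _ :=
  GRing.Zmodule_isLmodule.Build K dsum dscaleA dscale1 dscaleDr dscaleDl.

Definition single_fun (w : Q0 Q) (x : rsp X w) : forall v, rsp X v :=
  fun v => match pselect (w = v) with
           | left e => eq_rect w (rsp X) x v e
           | right _ => 0
           end.

Lemma fin_single (w : Q0 Q) (x : rsp X w) : finsupp_fun (single_fun x).
Proof.
exists [:: w] => v Hv; rewrite /single_fun; case: pselect => // e.
by exfalso; apply: Hv; left.
Qed.

Definition single (w : Q0 Q) (x : rsp X w) : dsum := DSum (fin_single x).

Definition act_idem (m : dsum) (w : Q0 Q) : dsum := single (dfun m w).
Definition act_arrow (m : dsum) (a : Q1 Q) : dsum :=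
  single (rmap X a (dfun m (qs a))).

Definition act_path (m : dsum) (p : path Q) : dsum :=
  foldl act_arrow (act_idem m (pstart p)) (parrows p).

Definition Gact (m : dsum) (x : KQ) : dsum :=
  \sum_(p <- msupp x) x@_p *: act_path m p.

Definition G : KQmodule := @KQModule dsum Gact.

End PathAlgebra.

(* Main.v *)
(* Only Ext^1 matters. Ext^1(G(X), KQ) = 0 says that for all linear forms
   phi_a on X_{s(a)} there are linear maps F_v : X_v -> KQ e_v with
   F_{t(a)}(X_a x) = F_{s(a)}(x) a - phi_a(x) e_{t(a)}
   (split the extension of G(X) by KQ with cocycle phi).
   Comparing coefficients of e_v shows that the arrow maps into a vertex v are
   jointly injective. If phi_a is nonzero whenever X_{s(a)} is, a path q ending
   at v occurs in the values of F_v as soon as some arrow a with X_{s(a)} <> 0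
   ends where q starts; X_v being finite dimensional, such q have bounded
   length, so the relation "arrow u -> v with X_u <> 0" is well founded. A
   section of an epimorphism onto G(X) is then built by recursion along it:
   joint injectivity makes the values prescribed on the images of the arrow
   maps into X_v consistent, and they are extended to X_v linearly. *)

From HB Require Import structures.
From mathcomp Require Import all_boot all_order all_algebra.
From mathcomp Require Import boolp finmap.
From mathcomp.multinomials Require Import monalg.
Require Import Defs.

Set Implicit Arguments.
Unset Strict Implicit.
Unset Printing Implicit Defensive.

Import GRing.Theory.
Local Open Scope ring_scope.

HB.instance Definition _ (Q : quiver) := gen_eqMixin (Q0 Q).
HB.instance Definition _ (Q : quiver) := gen_eqMixin (Q1 Q).

(** * Linear maps and linear relations *)

Section LinearProp.
Variables (K : fieldType) (V W : lmodType K) (f : V -> W).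
Hypothesis lf : linear f.

Lemma lin0 : f 0 = 0.
Proof. by have := lf (-1) 0 0; rewrite scaler0 addr0 scaleN1r addNr. Qed.

Lemma linD x y : f (x + y) = f x + f y.
Proof. by have := lf 1 x y; rewrite !scale1r. Qed.

Lemma linZ c x : f (c *: x) = c *: f x.
Proof. by have := lf c x 0; rewrite !addr0 lin0 addr0. Qed.

Lemma linN x : f (- x) = - f x.
Proof. by rewrite -scaleN1r linZ scaleN1r. Qed.

Lemma linB x y : f (x - y) = f x - f y.
Proof. by rewrite linD linN. Qed.

Lemma lin_sum (I : Type) (r : seq I) (P : pred I) (F : I -> V) :
  f (\sum_(i <- r | P i) F i) = \sum_(i <- r | P i) f (F i).
Proof. by apply: (big_morph f linD lin0). Qed.

End LinearProp.

Lemma linear_comp (K : fieldType) (U V W : lmodType K) (g : V -> W) (f : U -> V) :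
  linear g -> linear f -> linear (g \o f).
Proof. by move=> lg lf c x y /=; rewrite lf lg. Qed.

Lemma linear_of (K : fieldType) (V W : lmodType K) (f : V -> W) :
  (forall x y, f (x + y) = f x + f y) -> (forall c x, f (c *: x) = c *: f x) ->
  linear f.
Proof. by move=> fD fZ c x y; rewrite fD fZ. Qed.

(** * Linear extension from a basis *)

Section LinearExtension.
Variables (K : fieldType) (T : choiceType) (V : lmodType K).

Definition mlift (phi : T -> V) (z : {malg K[T]}) : V :=
  \sum_(k <- msupp z) z@_k *: phi k.

Lemma mliftEw (phi : T -> V) (z : {malg K[T]}) (d : {fset T}) :
  (msupp z `<=` d)%fset -> mlift phi z = \sum_(k <- d) z@_k *: phi k.
Proof.
move=> le; apply: big_fset_incl => // k _ /mcoeff_outdom ->.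
by rewrite scale0r.
Qed.

Lemma mlift_linear (phi : T -> V) : linear (mlift phi).
Proof.
move=> c x y; pose d := (msupp x `|` msupp y `|` msupp (c *: x + y)%R)%fset.
rewrite !(@mliftEw phi _ d) /d ?fsubsetUr //; last first.
- by rewrite -fsetUA fsubsetUl.
- by rewrite fsetUAC fsubsetUr.
rewrite scaler_sumr -big_split; apply: eq_bigr => k _.
by rewrite mcoeffD mcoeffZ scalerDl scalerA.
Qed.

Lemma mliftU (phi : T -> V) k : mlift phi << k >> = phi k.
Proof.
rewrite (@mliftEw _ _ [fset k]%fset) ?msuppU_le // big_seq_fset1 mcoeffUU.
by rewrite scale1r.
Qed.

Lemma malgZU (c : K) (k : T) : << c *g k >> = c *: << k >> :> {malg K[T]}.
Proof. by apply/malgP => k'; rewrite mcoeffZ !mcoeffU mulrnAr mulr1. Qed.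

Lemma malg_linear_ext (f g : {malg K[T]} -> V) :
  linear f -> linear g -> (forall k, f << k >> = g << k >>) -> f =1 g.
Proof.
move=> lf lg e z; rewrite [z]monalgE (lin_sum lf) (lin_sum lg).
by apply: eq_bigr => k _; rewrite malgZU (linZ lf) (linZ lg) e.
Qed.

End LinearExtension.

Lemma linear_zero (K : fieldType) (V W : lmodType K) :
  linear (fun _ : V => 0 : W).
Proof. by move=> c x y; rewrite scaler0 addr0. Qed.

Lemma mcoeff_linear (K : fieldType) (T : choiceType) (k : T) :
  linear (mcoeff k : {malg K[T]} -> K^o).
Proof. by move=> c x y; rewrite mcoeffD mcoeffZ. Qed.

Lemma sum_uniq_delta (V : zmodType) (T : eqType) (s : seq T) (t : T) (h : T -> V) :
  uniq s -> t \in s -> (forall u, u != t -> h u = 0) -> \sum_(u <- s) h u = h t.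
Proof. by move=> us ts h0; rewrite (bigD1_seq t) //= big1 ?addr0. Qed.

(** * Linear relations and their extension to linear maps *)

Section LinearRelations.
Variables (K : fieldType) (V : vectType K) (W : lmodType K).

(** A subspace of [V * W]. Lifts are prescribed on sums of images of arrow maps, where
    single-valuedness has to be proved, so the data come as a relation. *)
Definition linrel (A : V -> W -> Prop) : Prop :=
  A 0 0 /\ forall c x y x' y', A x y -> A x' y' -> A (c *: x + x') (c *: y + y').

(** For a linear relation, uniqueness over 0 gives uniqueness over every vector by subtraction. *)
Definition functional_rel (A : V -> W -> Prop) : Prop :=
  forall y, A 0 y -> y = 0.

Lemma linrel_sum (A : V -> W -> Prop) (I : Type) (r : seq I) (c : I -> K) F H :
  linrel A -> (forall i, A (F i) (H i)) ->
  A (\sum_(i <- r) c i *: F i) (\sum_(i <- r) c i *: H i).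
Proof.
move=> [A0 AD] AF; elim: r => [|i r IH]; first by rewrite !big_nil.
by rewrite !big_cons; apply: AD.
Qed.

(** If [e] is outside the domain of [A], the line through [(e, w)] with [C e w] is adjoined. A pair
    [(0, y)] using a nonzero multiple of [e] would put [e] in that domain. *)
Lemma linrel_extend1 (A C : V -> W -> Prop) (e : V) :
  linrel A -> linrel C -> functional_rel A ->
  (forall x y, A x y -> C x y) -> (exists y, C e y) ->
  exists B, [/\ linrel B, functional_rel B, forall x y, B x y -> C x y,
    forall x y, A x y -> B x y & exists y, B e y].
Proof.
move=> lA lC fA AC [w Cw].
have [[y Ay]|nA] := pselect (exists y, A e y).
  by exists A; split=> //; exists y.
have [A0 AD] := lA; have [C0 CD] := lC.
pose B x y := exists c : K, A (x - c *: e) (y - c *: w).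
exists B; split.
- split; first by exists 0; rewrite !scale0r !subr0.
  move=> c x y x' y' [k Ak] [k' Ak']; exists (c * k + k').
  have := AD c _ _ _ _ Ak Ak'.
  rewrite !scalerBr !scalerDl !scalerA !opprD.
  by rewrite !addrA -!(addrAC _ x') -!(addrAC _ y').
- move=> y [c Ac]; have [c0|cn0] := eqVneq c 0.
    by move: Ac; rewrite c0 !scale0r !subr0; apply: fA.
  case: nA; exists (- c^-1 *: (y - c *: w)).
  have := AD (- c^-1) _ _ _ _ Ac A0; rewrite !addr0.
  by rewrite sub0r scalerN scaleNr opprK scalerA mulVf // scale1r.
- move=> x y [c /AC Cc]; have := CD c _ _ _ _ Cw Cc.
  by rewrite ![c *: _ + _]addrC !subrK.
- by move=> x y Axy; exists 0; rewrite !scale0r !subr0.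
- by exists w; exists 1; rewrite !scale1r !subrr.
Qed.

(** The domain grows by one basis vector of [V] at a time, inside the total relation [C]; [W] may be
    infinite dimensional. *)
Lemma linrel_extend (A C : V -> W -> Prop) :
  linrel A -> linrel C -> functional_rel A ->
  (forall x y, A x y -> C x y) -> (forall x, exists y, C x y) ->
  exists h : V -> W, [/\ linear h, forall x, C x (h x) &
    forall x y, A x y -> h x = y].
Proof.
move=> lA lC fA AC Ct.
have [B [lB fB BC AB Bt]] : exists B, [/\ linrel B, functional_rel B,
    forall x y, B x y -> C x y, forall x y, A x y -> B x y &
    forall e, e \in tval (vbasis {:V}) -> exists y, B e y].
  elim: (tval (vbasis {:V})) => [|e s [B [lB fB BC AB Bt]]].
    by exists A; split=> // e; rewrite in_nil.
  have [D [lD fD DC BD De]] := linrel_extend1 lB lC fB BC (Ct e).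
  exists D; split=> // [x y /AB /BD //|e'].
  by rewrite inE => /orP[/eqP -> //|/Bt [y /BD]]; exists y.
have {}Bt x : exists y, B x y.
  have /choice [F BF] : forall i : 'I_(\dim {:V}), exists y, B (vbasis {:V})`_i y.
    by move=> i; apply: Bt; rewrite mem_nth // size_tuple.
  rewrite (coord_vbasis (memvf x)).
  by eexists; apply: linrel_sum; last exact: BF.
have [h Bh] := choice Bt; have [B0 BD] := lB.
have Bu x y y' : B x y -> B x y' -> y = y'.
  move=> b b'; apply/eqP; rewrite -subr_eq0; apply/eqP; apply: fB.
  by have := BD (-1) _ _ _ _ b' b; rewrite !scaleN1r addNr addrC.
exists h; split=> [c x y|x|x y /AB]; last exact: Bu.
  by apply: (@Bu (c *: x + y)) => //; apply: BD.
exact: BC.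
Qed.

End LinearRelations.

(** * Choice along a well-founded relation *)

Section WellFoundedChoice.
Variables (I : Type) (R : I -> I -> Prop) (T : I -> Type) (d : forall i, T i).
Variables (good : forall i, T i -> Prop).
Variables (step : forall i, (forall j, T j) -> T i -> Prop).
Hypothesis R_wf : well_founded R.

(** The recursion picks a witness if there is one and [d i] otherwise; induction shows that there
    always is one. Earlier values form a total family with default [d], so that [step] mentions no
    proof of [R j i]. *)
Lemma wf_choice :
  (forall i (prev : forall j, T j), (forall j, R j i -> good (prev j)) ->
     (forall j, ~ R j i -> prev j = d j) ->
     exists h : T i, good h /\ step prev h) ->
  exists g : forall i, T i, forall i, good (g i) /\
    step (fun j => match pselect (R j i) with left _ => g j | right _ => d j end) (g i).
Proof.
move=> ex.
pose body i (rec : forall j, R j i -> T j) : T i :=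
  let prev j := match pselect (R j i) with left r => rec j r | right _ => d j end in
  match pselect (exists h : T i, good h /\ step prev h) with
  | left e => projT1 (cid e)
  | right _ => d i
  end.
pose g := Fix R_wf T body.
have gE i : g i = body i (fun j _ => g j).
  rewrite /g Fix_eq // => j f f' ff'.
  congr body; apply: functional_extensionality_dep => k.
  by apply: functional_extensionality_dep => r; rewrite ff'.
exists g; elim/(well_founded_ind R_wf) => i IH.
have [|j nR|h hP] := ex i (fun j =>
  match pselect (R j i) with left _ => g j | right _ => d j end).
- by move=> j Rji; case: pselect => // r; case: (IH j r).
- by case: pselect.
rewrite gE /body; case: pselect => [e|[]]; last by exists h.
exact: (projT2 (cid e)).
Qed.

End WellFoundedChoice.

(** * Paths and the path algebra *)

Section Paths.
Variable Q : quiver.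
Implicit Types p q r : path Q.

Lemma path_eq p q : pstart p = pstart q -> parrows p = parrows q -> p = q.
Proof.
case: p q => [v s Hs] [w t Ht] /= e1 e2; subst w t.
by rewrite (Prop_irrelevance Hs Ht).
Qed.

Definition pcat p q (e : pend p = pstart q) : path Q := Path (concat_valid e).

Definition arr (a : Q1 Q) : path Q := @Path Q (qs a) [:: a] (conj erefl I).

Lemma pend_cat p q (e : pend p = pstart q) : pend (pcat e) = pend q.
Proof. by rewrite /pend /= map_cat last_cat -/(pend p) e. Qed.

Lemma composable_catl (v : Q0 Q) s t : composable v (s ++ t) -> composable v s.
Proof. by elim: s v => [|a s IH] v //= [-> /IH]. Qed.

Lemma composable_catr (v : Q0 Q) s t :
  composable v (s ++ t) -> composable (last v (map (@qt Q) s)) t.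
Proof. by elim: s v => [|a s IH] v //= [_ /IH]. Qed.

(** Induction on the last arrow fits right modules: [act_path] folds from the left, so each new
    arrow acts last. *)
Lemma path_rect_last (P : path Q -> Prop) :
  (forall v, P (triv_path v)) ->
  (forall p a (e : pend p = pstart (arr a)), P p -> P (pcat e)) ->
  forall p, P p.
Proof.
move=> P0 PS [v s Hs].
elim/last_ind: s Hs => [|s a IH] Hs.
  by have -> : Path Hs = triv_path v by apply: path_eq.
have Hs' : composable v (s ++ [:: a]) by rewrite cats1.
have Hl := composable_catl Hs'.
have e : pend (Path Hl) = pstart (arr a).
  by have [] := composable_catr Hs'.
have -> : Path Hs = pcat e by apply: path_eq => //=; rewrite cats1.
exact: PS.
Qed.

End Paths.

Section PathAlgebraTheory.
Variables (K : fieldType) (Q : quiver).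
Implicit Types (p q r : path Q) (x y : KQ K Q).

Definition bpath p : KQ K Q := << p >>.

Lemma pmul_cat p q (e : pend p = pstart q) : pmul K p q = bpath (pcat e).
Proof.
rewrite /pmul; case: pselect => // e'; congr mkmalgU; exact: path_eq.
Qed.

Lemma pmul_neq p q : pend p <> pstart q -> pmul K p q = 0.
Proof. by rewrite /pmul; case: pselect. Qed.

Lemma KQmulE x y : KQmul x y = mlift (fun p => mlift (pmul K p) y) x.
Proof.
rewrite /KQmul /mlift; apply: eq_bigr => p _; rewrite scaler_sumr.
by apply: eq_bigr => q _; rewrite scalerA.
Qed.

Lemma KQmul_linl y : linear (fun x => KQmul x y).
Proof. by move=> c x x'; rewrite !KQmulE mlift_linear. Qed.

Lemma KQmul_linr x : linear (KQmul x).
Proof.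
move=> c y y'; rewrite !KQmulE /mlift scaler_sumr -big_split.
apply: eq_bigr => p _ /=.
by rewrite -!/(mlift _ _) mlift_linear scalerDr !scalerA mulrC.
Qed.

Lemma KQmulU p q : KQmul (bpath p) (bpath q) = pmul K p q.
Proof. by rewrite KQmulE !mliftU. Qed.

Lemma KQmulA x y z : KQmul (KQmul x y) z = KQmul x (KQmul y z).
Proof.
move: x; apply: malg_linear_ext => [c u v|c u v|p].
- by rewrite !(KQmul_linl _ c).
- by rewrite (KQmul_linl _ c).
move: y; apply: malg_linear_ext => [c u v|c u v|q].
- by rewrite KQmul_linr (KQmul_linl _ c).
- by rewrite (KQmul_linl _ c) KQmul_linr.
move: z; apply: malg_linear_ext => [c u v|c u v|r].
- by rewrite KQmul_linr.
- by rewrite !KQmul_linr.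
rewrite !KQmulU.
have [e|ne] := pselect (pend p = pstart q); last first.
  rewrite (pmul_neq ne) (lin0 (KQmul_linl _)).
  have [e'|ne'] := pselect (pend q = pstart r); last first.
    by rewrite (pmul_neq ne') (lin0 (KQmul_linr _)).
  by rewrite (pmul_cat e') KQmulU pmul_neq.
rewrite (pmul_cat e) KQmulU.
have [e'|ne'] := pselect (pend q = pstart r); last first.
  by rewrite (pmul_neq ne') (lin0 (KQmul_linr _)) pmul_neq // pend_cat.
have e1 : pend (pcat e) = pstart r by rewrite pend_cat.
have e2 : pend p = pstart (pcat e') by [].
rewrite (pmul_cat e1) (pmul_cat e') KQmulU (pmul_cat e2).
by congr mkmalgU; apply: path_eq => //=; rewrite catA.
Qed.

Lemma pmul_trivl v p : pstart p = v -> pmul K (triv_path v) p = bpath p.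
Proof.
by move=> e; rewrite (@pmul_cat (triv_path v) p (esym e)); congr mkmalgU; apply: path_eq.
Qed.

Lemma pmul_trivr v p : pend p = v -> pmul K p (triv_path v) = bpath p.
Proof.
move=> e; rewrite (@pmul_cat p (triv_path v) e); congr mkmalgU; apply: path_eq => //=.
by rewrite cats0.
Qed.

Lemma idem_mul v p : pstart p = v -> KQmul (idem K v) (bpath p) = bpath p.
Proof. by move=> e; rewrite KQmulU pmul_trivl. Qed.

Lemma mul_idem v p : pend p = v -> KQmul (bpath p) (idem K v) = bpath p.
Proof. by move=> e; rewrite KQmulU pmul_trivr. Qed.

Lemma idem_idem (v w : Q0 Q) :
  KQmul (idem K v) (idem K w) = if v == w then idem K v else 0.
Proof.
case: eqP => [<-|ne]; first exact: mul_idem.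
by rewrite KQmulU pmul_neq.
Qed.

(** * Modules *)

Record premodule (M : KQmodule K Q) : Prop := Premodule {
  act_linl : forall x, linear (fun m : mcar M => mact m x);
  act_linr : forall m : mcar M, linear (mact m);
  actA : forall (m : mcar M) x y, mact (mact m x) y = mact m (KQmul x y) }.

Lemma module_premodule M : is_module M -> premodule M.
Proof.
case=> h1 h2 h3 h4 [h5 _]; split=> //.
- by move=> x; apply: linear_of.
- by move=> m; apply: linear_of.
Qed.

(** The trivial paths are orthogonal idempotents, so [m] is fixed by the sum of the distinct ones
    involved; [undup] keeps a vertex from counting twice. *)
Lemma premodule_module M : premodule M ->
  (forall m : mcar M, exists s : seq (mcar M * Q0 Q),
     m = \sum_(i <- s) mact i.1 (idem K i.2)) ->
  is_module M.
Proof.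
move=> pM span; split=> [m m' x|m x x'|c m x|c m x|].
- exact: (linD (act_linl pM x)).
- exact: (linD (act_linr pM m)).
- exact: (linZ (act_linl pM x)).
- exact: (linZ (act_linr pM m)).
split=> [|m]; first exact: actA.
have [s ->] := span m.
exists (undup [seq i.2 | i <- s]).
under [RHS]eq_bigr => v _ do rewrite (lin_sum (act_linl pM _)).
rewrite exchange_big /= !big_seq; apply: eq_bigr => i si.
rewrite (@sum_uniq_delta _ _ _ i.2); rewrite ?undup_uniq //.
- by rewrite (actA pM) idem_idem eqxx.
- by rewrite mem_undup map_f.
move=> u nu; rewrite (actA pM) idem_idem eq_sym (negPf nu).
exact: (lin0 (act_linr pM _)).
Qed.

Lemma hom_linear (M N : KQmodule K Q) (f : mcar M -> mcar N) :
  is_hom f -> linear f.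
Proof. by case=> h1 h2 _; apply: linear_of. Qed.

Lemma hom_act (M N : KQmodule K Q) (f : mcar M -> mcar N) m x :
  is_hom f -> f (mact m x) = mact (f m) x.
Proof. by case. Qed.

Lemma act_triv (M : KQmodule K Q) (m : mcar M) v :
  premodule M -> mact (mact m (idem K v)) (idem K v) = mact m (idem K v).
Proof. by move=> pM; rewrite (actA pM) idem_idem eqxx. Qed.

(** * Modules from operators for vertices and arrows *)

Section ArrowAction.
Variables (V : lmodType K) (ev : V -> Q0 Q -> V) (al : V -> Q1 Q -> V).

(** The relations of the path algebra: orthogonal idempotents [e_v], and [a = e_s a e_t] for an
    arrow [a] from [s] to [t]. *)
Record arrow_action : Prop := ArrowAction {
  ev_lin : forall v, linear (ev^~ v);
  al_lin : forall a, linear (al^~ a);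
  ev_ev : forall m v, ev (ev m v) v = ev m v;
  ev_neq : forall m v w, v <> w -> ev (ev m v) w = 0;
  al_ev : forall m a, al (ev m (qs a)) a = al m a;
  ev_al : forall m a, ev (al m a) (qt a) = al m a }.

Definition arrow_path (m : V) (p : path Q) : V :=
  foldl al (ev m (pstart p)) (parrows p).

Definition arrow_module : KQmodule K Q :=
  @KQModule K Q V (fun m x => mlift (arrow_path m) x).

Hypothesis A : arrow_action.

Lemma arrow_path_cat m p a (e : pend p = pstart (arr a)) :
  arrow_path m (pcat e) = al (arrow_path m p) a.
Proof. by rewrite /arrow_path /= foldl_cat. Qed.

Lemma arrow_path_arr m a : arrow_path m (arr a) = al m a.
Proof. by rewrite /arrow_path /= (al_ev A). Qed.

Lemma arrow_path_lin p : linear (arrow_path^~ p).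
Proof.
elim/path_rect_last: p => [v|p a e IH] c m n; first exact: (ev_lin A).
by rewrite !arrow_path_cat IH (al_lin A).
Qed.

Lemma arrow_path_end m p : ev (arrow_path m p) (pend p) = arrow_path m p.
Proof.
elim/path_rect_last: p => [v|p a e IH]; first exact: (ev_ev A).
by rewrite pend_cat !arrow_path_cat (ev_al A).
Qed.

Lemma arrow_path_mul m p q (e : pend p = pstart q) :
  arrow_path (arrow_path m p) q = arrow_path m (pcat e).
Proof. by rewrite {1}/arrow_path -e arrow_path_end /arrow_path /= foldl_cat. Qed.

Lemma arrow_path_neq m p q : pend p <> pstart q ->
  arrow_path (arrow_path m p) q = 0.
Proof.
move=> ne; rewrite {1}/arrow_path -arrow_path_end (ev_neq A) //.
elim: (parrows q) => //= a s; suff -> : al 0 a = 0 by [].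
exact: (lin0 (al_lin A a)).
Qed.

(** Associativity reduces to two paths. If they do not compose, the first result lies at [pend p]
    and the starting vertex of the second path kills it. *)
Lemma arrow_premodule : premodule arrow_module.
Proof.
split=> /= [x c m n|m|m x y].
- rewrite /mlift scaler_sumr -big_split; apply: eq_bigr => p _ /=.
  by rewrite arrow_path_lin scalerDr !scalerA mulrC.
- exact: mlift_linear.
have ll x' : linear (fun m' => mlift (arrow_path m') x').
  move=> c u v; rewrite /mlift scaler_sumr -big_split; apply: eq_bigr => p _ /=.
  by rewrite arrow_path_lin scalerDr !scalerA mulrC.
move: x; apply: malg_linear_ext => [c u v|c u v|p].
- by rewrite mlift_linear ll.
- by rewrite (KQmul_linl _ c) mlift_linear.
move: y; apply: malg_linear_ext => [c u v|c u v|q].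
- by rewrite mlift_linear.
- by rewrite KQmul_linr mlift_linear.
rewrite !mliftU KQmulU.
have [e|ne] := pselect (pend p = pstart q).
  by rewrite (pmul_cat e) mliftU (arrow_path_mul _ e).
by rewrite (pmul_neq ne) (lin0 (mlift_linear _)) arrow_path_neq.
Qed.

End ArrowAction.

(** * Free modules *)

Section FreeModule.
Variable A : choiceType.

Definition inj_gen (i : A) (x : KQ K Q) : {malg K[(A * path Q)%type]} :=
  mlift (fun p => << (i, p) >>) x.

Definition free_act (z : {malg K[(A * path Q)%type]}) (x : KQ K Q) :=
  mlift (fun ip => inj_gen ip.1 (KQmul (bpath ip.2) x)) z.

(** A direct sum of copies of [KQ] indexed by [A]. As [KQ] may lack an identity, the generators are
    the [gen i (triv_path v)], one per index and vertex. *)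
Definition free_module : KQmodule K Q := @KQModule K Q _ free_act.

Definition gen (i : A) (p : path Q) : mcar free_module := << (i, p) >>.

Lemma inj_gen_lin i : linear (inj_gen i).
Proof. exact: mlift_linear. Qed.

Lemma free_actU i p x : mact (gen i p) x = inj_gen i (KQmul (bpath p) x).
Proof. by rewrite /= /free_act mliftU. Qed.

Lemma free_linl x : linear (free_act^~ x).
Proof. exact: mlift_linear. Qed.

Lemma free_linr z : linear (free_act z).
Proof.
move=> c x y; rewrite /free_act /mlift scaler_sumr -big_split.
apply: eq_bigr => ip _ /=.
by rewrite KQmul_linr inj_gen_lin scalerDr !scalerA mulrC.
Qed.

Lemma inj_gen_act i x y : free_act (inj_gen i x) y = inj_gen i (KQmul x y).
Proof.
move: x; apply: malg_linear_ext => [c u v|c u v|p].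
- by rewrite inj_gen_lin free_linl.
- by rewrite (KQmul_linl _ c) inj_gen_lin.
by rewrite {1}/inj_gen mliftU; exact: free_actU.
Qed.

Lemma free_premodule : premodule free_module.
Proof.
split; [exact: free_linl | exact: free_linr | move=> z x y].
move: z; apply: malg_linear_ext => [c u v|c u v|[i p]].
- by rewrite /= !free_linl.
- by rewrite /= free_linl.
by rewrite -/(gen i p) !free_actU /= inj_gen_act KQmulA.
Qed.

Lemma gen_end i p : mact (gen i p) (idem K (pend p)) = gen i p.
Proof. by rewrite free_actU mul_idem // /inj_gen mliftU. Qed.

Lemma gen_start i p : mact (gen i (triv_path (pstart p))) (bpath p) = gen i p.
Proof. by rewrite free_actU idem_mul // /inj_gen mliftU. Qed.

Lemma free_is_module : is_module free_module.
Proof.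
apply: premodule_module free_premodule _ => z.
exists [seq (z@_k *: gen k.1 k.2, pend k.2) | k <- msupp z].
rewrite big_map {1}[z]monalgE; apply: eq_bigr => -[i p] _.
by rewrite malgZU [RHS](linZ (free_linl _)); have /= -> := gen_end i p.
Qed.

Section Universal.
Variables (N : KQmodule K Q) (tau : A -> Q0 Q -> mcar N).

(** [tau i v] may be any element of [N]: acting by a path from [v] first projects to the part of [N]
    at [v]. *)
Definition free_hom (z : mcar free_module) : mcar N :=
  mlift (fun ip => mact (tau ip.1 (pstart ip.2)) (bpath ip.2)) z.

Hypothesis pN : premodule N.

Lemma free_hom_lin : linear free_hom.
Proof. exact: mlift_linear. Qed.

Lemma free_hom_gen i p : free_hom (gen i p) = mact (tau i (pstart p)) (bpath p).
Proof. by rewrite /free_hom mliftU. Qed.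

Lemma free_hom_is_hom : is_hom free_hom.
Proof.
split; [exact: linD free_hom_lin | exact: linZ free_hom_lin | move=> z x].
move: z; apply: malg_linear_ext => [c u v|c u v|[i p]].
- by rewrite (act_linl free_premodule) free_hom_lin.
- by rewrite free_hom_lin (act_linl pN).
rewrite -/(gen i p).
move: x; apply: malg_linear_ext => [c u v|c u v|q].
- by rewrite (act_linr free_premodule) free_hom_lin.
- exact: (act_linr pN).
rewrite free_hom_gen (actA pN) free_actU KQmulU.
have [e|ne] := pselect (pend p = pstart q).
  by rewrite (pmul_cat e) /inj_gen mliftU free_hom_gen.
rewrite (pmul_neq ne) (lin0 (inj_gen_lin _)) (lin0 free_hom_lin).
by rewrite (lin0 (act_linr pN _)).
Qed.

End Universal.

Lemma hom_free_ext (N : KQmodule K Q) (f g : mcar free_module -> mcar N) :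
  is_hom f -> is_hom g ->
  (forall i v, f (gen i (triv_path v)) = g (gen i (triv_path v))) -> f =1 g.
Proof.
move=> hf hg e; apply: malg_linear_ext (hom_linear hf) (hom_linear hg) _ => -[i p].
rewrite -/(gen i p) -gen_start (hom_act _ _ hf) (hom_act _ _ hg).
by rewrite e.
Qed.

Lemma free_projective : projective free_module.
Proof.
move=> N /module_premodule pN f hf fsurj.
have /choice [n nP] := fun iv : A * Q0 Q => fsurj (gen iv.1 (triv_path iv.2)).
exists (free_hom (fun i v => mact (n (i, v)) (idem K v))).
have hh := free_hom_is_hom (fun i v => mact (n (i, v)) (idem K v)) pN.
split=> // z.
have hfg : is_hom (f \o free_hom (fun i v => mact (n (i, v)) (idem K v))).
  split=> /= [u v|c u|u x].
  - by rewrite (linD (free_hom_lin _)) (linD (hom_linear hf)).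
  - by rewrite (linZ (free_hom_lin _)) (linZ (hom_linear hf)).
  - by rewrite (hom_act _ _ hh) (hom_act _ _ hf).
have hid : is_hom (fun z : mcar free_module => z) by split.
apply: (hom_free_ext hfg hid) => i v /=.
rewrite free_hom_gen /= (act_triv _ _ pN) (hom_act _ _ hf) nP /=.
exact: gen_end.
Qed.

End FreeModule.
End PathAlgebraTheory.

(** * Free resolutions *)

Section FreeResolution.
Variables (K : fieldType) (Q : quiver).

Definition submodule (A : KQmodule K Q) (S : mcar A -> Prop) : Prop :=
  [/\ S 0, forall m n, S m -> S n -> S (m + n), forall c m, S m -> S (c *: m)
    & forall m x, S m -> S (mact m x)].

Lemma ker_submodule (A B : KQmodule K Q) (f : mcar A -> mcar B) :
  premodule B -> is_hom f -> submodule (fun m => f m = 0).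
Proof.
move=> pB hf; have lf := hom_linear hf; split=> [|m n fm fn|c m fm|m x fm].
- exact: lin0.
- by rewrite (linD lf) fm fn addr0.
- by rewrite (linZ lf) fm scaler0.
- by rewrite (hom_act _ _ hf) fm; exact: (lin0 (act_linl pB x)).
Qed.

Section Cover.
Variables (A : KQmodule K Q) (S : mcar A -> Prop).

(* Generators outside [S] are sent to 0, so that the image is [S] and no
   module structure on the subtype [S] is needed. *)
Definition cover_map : mcar (free_module K Q (mcar A)) -> mcar A :=
  free_hom (fun m v => if `[< S m >] then mact m (idem K v) else 0).

Hypothesis mA : is_module A.

Lemma cover_hom : is_hom cover_map.
Proof. exact: free_hom_is_hom (module_premodule mA). Qed.

Lemma cover_gen m p : S m -> cover_map (gen K m p) = mact m (bpath K p).
Proof.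
move=> Sm; have pA := module_premodule mA.
by rewrite /cover_map free_hom_gen; case: asboolP => // _; rewrite (actA pA) idem_mul.
Qed.

(** Unitarity writes [y] as a sum of elements [y e_v], which are images of generators; conversely,
    [S] contains the images of the generators and is closed under the action. *)
Lemma cover_image : submodule S -> forall y, S y <-> exists z, cover_map z = y.
Proof.
move=> [S0 SD SZ SM] y; have pA := module_premodule mA; split=> [Sy|[z <-]].
  case: (mA) => _ _ _ _ [_ /(_ y) [s ys]].
  exists (\sum_(v <- s) gen K y (triv_path v)).
  rewrite (lin_sum (hom_linear cover_hom)) [RHS]ys; apply: eq_bigr => v _.
  by rewrite cover_gen.
rewrite /cover_map /free_hom /mlift.
apply: (big_ind S) => // -[m p] _; apply: (SZ); apply: (SM) => /=.
by case: asboolP => // Sm; apply: SM.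
Qed.

End Cover.

Record stage := Stage { sg_mod : KQmodule K Q; sg_sub : mcar sg_mod -> Prop }.

Definition next_stage (s : stage) : stage :=
  @Stage (free_module K Q (mcar (sg_mod s))) (fun z => cover_map (@sg_sub s) z = 0).

Definition res_stage (M : KQmodule K Q) (n : nat) : stage :=
  iter n next_stage (@Stage M (fun _ => True)).

(** Stage 0 is [M] itself, hence the shift: degree [n] holds the module of stage [n.+1]. *)
Definition free_res (M : KQmodule K Q) : projres M :=
  @ProjRes K Q M (fun n => sg_mod (res_stage M n.+1))
    (fun n => cover_map (@sg_sub (res_stage M n.+1)))
    (cover_map (@sg_sub (res_stage M 0))).

Lemma res_stageP M n : is_module M ->
  is_module (sg_mod (res_stage M n)) /\ submodule (@sg_sub (res_stage M n)).
Proof.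
move=> mM; elim: n => [|n [mn sn]]; first by split.
split; first exact: free_is_module.
exact: ker_submodule (module_premodule mn) (cover_hom _ mn).
Qed.

(** Exactness is [cover_image] for the kernel of the preceding map. [Ext_zero] ranges over all
    projective resolutions, so it can be applied to this one. *)
Lemma free_res_is_projres M : is_module M -> is_projres (free_res M).
Proof.
move=> mM; have stP n := res_stageP n mM.
split=> [n|n||y|].
- by split; [exact: free_is_module | exact: free_projective].
- by apply: cover_hom; case: (stP n.+1).
- exact: cover_hom.
- by have [_ sn] := stP 0; apply/(cover_image mM sn).
split=> [y|n y].
  by have [mn sn] := stP 1; exact: (cover_image mn sn).
by have [mn sn] := stP n.+2; exact: (cover_image mn sn).
Qed.

End FreeResolution.

(** * The module of a representation *)

Arguments dfun : simpl never.

Section Representation.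
Variables (K : fieldType) (Q : quiver) (X : rep K Q).
Implicit Types (m n : dsum X) (v w : Q0 Q) (a b : Q1 Q).

Lemma single_eq w (x : rsp X w) : dfun (single x) w = x.
Proof.
rewrite /dfun /= /single_fun; case: pselect => // e.
by rewrite (Prop_irrelevance e erefl).
Qed.

Lemma single_neq w v (x : rsp X w) : w <> v -> dfun (single x) v = 0.
Proof. by rewrite /dfun /= /single_fun; case: pselect. Qed.

Lemma dfun_lin v : linear (fun m => dfun m v).
Proof. by []. Qed.

Lemma single_lin w : linear (@single K Q X w).
Proof.
move=> c x y; apply: dsum_eq => v.
rewrite dfun_lin; have [e|ne] := pselect (w = v).
  by subst v; rewrite !single_eq.
by rewrite !single_neq // scaler0 addr0.
Qed.

Lemma act_idem_neq m v w : v <> w -> act_idem (act_idem m v) w = 0.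
Proof.
by move=> ne; rewrite /act_idem single_neq // (lin0 (@single_lin w)).
Qed.

Lemma G_arrow_action : arrow_action (@act_idem K Q X) (@act_arrow K Q X).
Proof.
split=> [v c m n|a c m n|m v|m v w|m a|m a].
- by rewrite /act_idem dfun_lin single_lin.
- by rewrite /act_arrow dfun_lin linearP single_lin.
- by rewrite /act_idem single_eq.
- exact: act_idem_neq.
- by rewrite /act_arrow /act_idem single_eq.
- by rewrite /act_idem /act_arrow single_eq.
Qed.

Lemma G_premodule : premodule (G X).
Proof. exact: arrow_premodule G_arrow_action. Qed.

Lemma act_path_cat m p a (e : pend p = pstart (arr a)) :
  act_path m (pcat e) = act_arrow (act_path m p) a.
Proof. by rewrite /act_path /= foldl_cat. Qed.

Lemma act_path_idem m v : mact (m : mcar (G X)) (idem K v) = act_idem m v.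
Proof. by rewrite /= /Gact -/(mlift _ _) mliftU. Qed.

Lemma act_path_arr m a : mact (m : mcar (G X)) (bpath K (arr a)) = act_arrow m a.
Proof.
rewrite /= /Gact -/(mlift _ _) mliftU.
exact: (arrow_path_arr G_arrow_action).
Qed.

Lemma dsum_decomp m (s : seq (Q0 Q)) : uniq s ->
  (forall v, v \notin s -> dfun m v = 0) -> m = \sum_(v <- s) single (dfun m v).
Proof.
move=> us ms; apply: dsum_eq => w.
rewrite (lin_sum (@dfun_lin w)); have [ws|/[dup] ws /ms ->] := boolP (w \in s).
  rewrite (@sum_uniq_delta _ _ s w (fun v => dfun (single (dfun m v)) w)) //.
    by rewrite single_eq.
  by move=> u /eqP nu; rewrite single_neq.
rewrite big_seq big1 // => v vs; rewrite single_neq // => e.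
by rewrite -e vs in ws.
Qed.

Lemma In_mem (T : eqType) (t : T) (s : seq T) : List.In t s <-> t \in s.
Proof.
elim: s => [|u s IH] //=; rewrite inE; split.
  by case=> [->|/IH ->]; rewrite ?eqxx ?orbT.
by case/orP => [/eqP ->|/IH]; [left | right].
Qed.

Lemma dsum_supp m : exists2 s : seq (Q0 Q), uniq s &
  forall v, v \notin s -> dfun m v = 0.
Proof.
have [s sP] := dfin m; exists (undup s); first exact: undup_uniq.
by move=> v; rewrite mem_undup => vs; apply: sP => /In_mem; rewrite (negPf vs).
Qed.

Lemma G_module : is_module (G X).
Proof.
apply: premodule_module G_premodule _ => m.
have [s us sP] := dsum_supp m.
exists [seq (m, v) | v <- s]; rewrite big_map.
rewrite {1}(dsum_decomp us sP); apply: eq_bigr => v _.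
by rewrite act_path_idem.
Qed.

(** * Vanishing of the first extension group *)

Section Twist.
Variable phi : forall a, rsp X (qs a) -> K.
Hypothesis phi_lin : forall a, linear (@phi a : rsp X (qs a) -> K^o).

Definition twist_idem (u : dsum X * KQ K Q) v : dsum X * KQ K Q :=
  (act_idem u.1 v, KQmul u.2 (idem K v)).

(** The cocycle term is a multiple of the trivial path at [qt a], hence fixed by that idempotent, as
    [ev_al] demands. *)
Definition twist_arrow (u : dsum X * KQ K Q) a : dsum X * KQ K Q :=
  (act_arrow u.1 a,
   KQmul u.2 (bpath K (arr a)) + @phi a (dfun u.1 (qs a)) *: idem K (qt a)).

Let GA := G_arrow_action.
Let linl (y : KQ K Q) := @KQmul_linl K Q y.

Lemma twist_action : arrow_action twist_idem twist_arrow.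
Proof.
split=> [v c u w|a c u w|u v|u v w ne|u a|u a].
- by rewrite /twist_idem (ev_lin GA) linl.
- rewrite /twist_arrow (al_lin GA) linl; congr pair => /=.
  by rewrite phi_lin scalerDl -!scalerA scalerDr addrACA.
- by rewrite /twist_idem /= (ev_ev GA) KQmulA idem_idem eqxx.
- rewrite /twist_idem /= (ev_neq GA) // KQmulA idem_idem.
  by case: eqP => // _; rewrite (lin0 (@KQmul_linr _ _ _)).
- rewrite /twist_arrow /= (al_ev GA) KQmulA idem_mul //.
  by rewrite /act_idem single_eq.
- rewrite /twist_arrow /twist_idem /= (ev_al GA) (linD (linl _)) (linZ (linl _)).
  by rewrite KQmulA mul_idem // idem_idem eqxx.
Qed.

(* The extension of [G X] by [KQ] with cocycle [phi]. *)
Definition twist : KQmodule K Q := arrow_module twist_idem twist_arrow.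

Lemma twist_fst (u : mcar twist) x : (mact u x).1 = mact (u.1 : mcar (G X)) x.
Proof.
rewrite /=; move: x; apply: malg_linear_ext => [c x y|c x y|p].
- by rewrite mlift_linear.
- exact: (act_linr G_premodule).
rewrite mliftU /= /Gact -/(mlift _ _) mliftU.
by elim/path_rect_last: p => // p a e IH; rewrite arrow_path_cat act_path_cat -IH.
Qed.

Lemma twist_snd (y : KQ K Q) x : mact ((0, y) : mcar twist) x = (0, KQmul y x).
Proof.
move: x; apply: malg_linear_ext => [c x x'|c x x'|p].
- exact: mlift_linear.
- by rewrite KQmul_linr; congr pair; rewrite /= scaler0 addr0.
rewrite /= mliftU; elim/path_rect_last: p => [v|p a e IH].
  by rewrite /arrow_path /= /twist_idem /= (lin0 (ev_lin GA v)).
rewrite arrow_path_cat IH /twist_arrow /= (lin0 (al_lin GA a)).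
rewrite -/(bpath K (pcat e)) -(pmul_cat _ e) -KQmulU KQmulA.
by rewrite (lin0 (@phi_lin a)) scale0r addr0.
Qed.

Lemma twist_arr m a : mact ((m, 0) : mcar twist) (bpath K (arr a)) =
  (act_arrow m a, @phi a (dfun m (qs a)) *: idem K (qt a)).
Proof.
rewrite /= mliftU (arrow_path_arr twist_action) /twist_arrow /=.
by rewrite (lin0 (linl _)) add0r.
Qed.

Lemma twist_idemE m v :
  mact ((m, 0) : mcar twist) (idem K v) = (act_idem m v, 0).
Proof.
by rewrite /= mliftU /arrow_path /= /twist_idem /= (lin0 (linl _)).
Qed.

Lemma twist_premodule : premodule twist.
Proof. exact: arrow_premodule twist_action. Qed.

(* The second component of the hom [th] from the free cover to [twist] is
   KQ-linear on the kernel of [eps], so the hypothesis extends it to a hom [g]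
   on the whole cover, and the difference factors through [eps]. *)
Lemma ext1_splitting : Ext_zero (G X) (KQreg K Q) 1 ->
  exists F : Q0 Q -> dsum X -> KQ K Q,
    [/\ forall v, linear (F v),
        forall v m, F v (act_idem m v) = F v m &
        forall a m, F (qt a) (act_arrow m a) =
          KQmul (F (qs a) m) (bpath K (arr a)) - @phi a (dfun m (qs a)) *: idem K (qt a)].
Proof.
move=> /(_ _ (free_res_is_projres G_module)) ext.
pose eps : mcar (free_module K Q (dsum X)) -> mcar (G X) :=
  @pr_eps _ _ _ (free_res (G X)).
pose th : mcar (free_module K Q (dsum X)) -> mcar twist :=
  free_hom (N := twist) (fun m v => (act_idem m v, 0 : KQ K Q)).
have pT := twist_premodule.
have heps : is_hom eps by exact: (cover_hom _ G_module).
have hth : is_hom th by exact: free_hom_is_hom.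
have leps := hom_linear heps; have lth := hom_linear hth.
have epsU m p : eps (gen K m p) = mact (m : mcar (G X)) (bpath K p).
  exact: (cover_gen G_module).
have thU m v : th (gen K m (triv_path v)) = (act_idem m v, 0).
  rewrite /th free_hom_gen /= -/(idem K v).
  by have /= -> := twist_idemE (act_idem m v) v; rewrite (ev_ev GA).
have tha m a : th (gen K m (arr a)) =
    (act_arrow m a, @phi a (dfun m (qs a)) *: idem K (qt a)).
  rewrite /th free_hom_gen /=; have /= -> := twist_arr (act_idem m (qs a)) a.
  by rewrite (al_ev GA) /act_idem single_eq.
have th1 z : (th z).1 = eps z.
  move: z; apply: malg_linear_ext => [c x y|c x y|[m p]]; rewrite ?lth ?leps //.
  rewrite -!/(gen K m p) epsU /th free_hom_gen twist_fst.
  rewrite -[LHS]/(mact (act_idem m (pstart p) : mcar (G X)) (bpath K p)).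
  by rewrite -act_path_idem (actA G_premodule) idem_mul.
pose d1 := @pr_d _ _ _ (free_res (G X)) 0.
have [_ hd _ _ [exeps exd]] := free_res_is_projres G_module.
have hd1 : is_hom d1 := hd 0%N.
have ld1 := hom_linear hd1.
have epsd y : eps (d1 y) = 0 by apply/exeps; exists y.
have thd y : th (d1 y) = (0, (th (d1 y)).2).
  by rewrite -(epsd y) -th1; case: (th _).
have hf : is_hom (fun y => (th (d1 y)).2 : mcar (KQreg K Q)).
  split=> [y y'|c y|y x].
  - by rewrite (linD ld1) (linD lth).
  - by rewrite (linZ ld1) (linZ lth).
  - by rewrite (hom_act _ _ hd1) (hom_act _ _ hth) thd twist_snd.
have [y|g [hg gP]] := ext _ hf.
  have -> : d1 (pr_d y) = 0 by apply/exd; exists y.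
  by rewrite (lin0 lth).
have {}gP z : eps z = 0 -> g z = (th z).2.
  by move=> /exeps [y <-]; rewrite -gP.
have lg := hom_linear hg.
(* Each of the three identities is [gP] at an element [z] of the kernel of [eps] that encodes it. *)
exists (fun v m => g (gen K m (triv_path v))); split=> [v c m n|v m|a m].
- pose z := gen K (c *: m + n) (triv_path v) -
    (c *: gen K m (triv_path v) + gen K n (triv_path v)).
  have ez : eps z = 0.
    by rewrite /z (linB leps) leps !epsU (act_linl G_premodule) subrr.
  have := gP z ez; rewrite /z (linB lg) lg (linB lth) lth !thU /=.
  by rewrite scaler0 addr0 subrr => /eqP; rewrite subr_eq0 => /eqP.
- pose z := gen K (act_idem m v) (triv_path v) - gen K m (triv_path v).
  have ez : eps z = 0.
    by rewrite /z (linB leps) !epsU !act_path_idem (ev_ev GA) subrr.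
  have := gP z ez; rewrite /z (linB lg) (linB lth) !thU /=.
  by rewrite subrr => /eqP; rewrite subr_eq0 => /eqP.
- pose z := gen K m (arr a) - gen K (act_arrow m a) (triv_path (qt a)).
  have ez : eps z = 0.
    by rewrite /z (linB leps) !epsU act_path_idem act_path_arr (ev_al GA) subrr.
  have := gP z ez; rewrite /z (linB lg) (linB lth) tha !thU.
  rewrite -{1}(gen_start K m (arr a)) (hom_act _ _ hg) /= subr0 => <-.
  by rewrite subKr.
Qed.

End Twist.
End Representation.

(** * Consequences for the representation *)

Section ArrowCoefficients.
Variables (K : fieldType) (Q : quiver).
Implicit Types (y : KQ K Q) (p : path Q) (a : Q1 Q).

Lemma coef_mul_arr_triv y a v : (KQmul y (bpath K (arr a)))@_(triv_path v) = 0.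
Proof.
move: y; apply: (@malg_linear_ext _ _ K^o) => [c y y'|c y y'|p].
- by rewrite KQmul_linl mcoeff_linear.
- by rewrite scaler0 addr0.
rewrite KQmulU; have [e|ne] := pselect (pend p = pstart (arr a)).
  rewrite (pmul_cat _ e) mcoeffU; case: eqP => // /(congr1 (@parrows Q)) /=.
  by case: (parrows p).
by rewrite (pmul_neq _ ne) mcoeff0.
Qed.

(** Appending a fixed arrow is injective on paths, so no other path of [y] contributes. *)
Lemma coef_mul_arr_cat y p a (e : pend p = pstart (arr a)) :
  (KQmul y (bpath K (arr a)))@_(pcat e) = y@_p.
Proof.
move: y; apply: (@malg_linear_ext _ _ K^o) => [c y y'|c y y'|q].
- by rewrite KQmul_linl mcoeff_linear.
- exact: mcoeff_linear.
rewrite KQmulU mcoeffU; have [e'|ne] := pselect (pend q = pstart (arr a)).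
  rewrite (pmul_cat _ e') mcoeffU; congr (_ *+ nat_of_bool _).
  apply/eqP/eqP => [qp|qp]; last by subst q; apply: path_eq.
  have /= es := congr1 (@pstart Q) qp.
  have /= := congr1 (@parrows Q) qp; rewrite !cats1 => /rcons_inj [ea].
  exact: path_eq.
rewrite (pmul_neq _ ne) mcoeff0; case: eqP => // qp.
by case: ne; rewrite qp.
Qed.

Lemma coef_idem_cat v p a (e : pend p = pstart (arr a)) :
  (idem K v)@_(pcat e) = 0.
Proof.
rewrite mcoeffU; case: eqP => // /(congr1 (@parrows Q)) /=.
by case: (parrows p).
Qed.

End ArrowCoefficients.

(** * Joint injectivity and well-foundedness from splittings *)

Section ExtVanishing.
Variables (K : fieldType) (Q : quiver) (X : rep K Q).
Hypothesis ext1 : Ext_zero (G X) (KQreg K Q) 1.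

Section Splitting.
Variables (phi : forall a : Q1 Q, rsp X (qs a) -> K) (F : Q0 Q -> dsum X -> KQ K Q).
Hypothesis F_lin : forall v, linear (F v).
Hypothesis F_idem : forall v m, F v (act_idem m v) = F v m.
Hypothesis F_arrow : forall a m, F (qt a) (act_arrow m a) =
  KQmul (F (qs a) m) (bpath K (arr a)) - @phi a (dfun m (qs a)) *: idem K (qt a).

(** Products with an arrow contain no trivial path, so at [v = qt a] only the cocycle remains;
    otherwise the component seen by [F v] is 0. *)
Lemma splitting_coef_triv v a m : (F v (act_arrow m a))@_(triv_path v) =
  if qt a == v then - @phi a (dfun m (qs a)) else 0.
Proof.
case: eqP => [<-|ne].
  by rewrite F_arrow mcoeffB coef_mul_arr_triv mcoeffZ mcoeffUU mulr1 sub0r.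
rewrite -F_idem -(ev_al (G_arrow_action X)) act_idem_neq //.
by rewrite (lin0 (@F_lin v)) mcoeff0.
Qed.

(** Each arrow carries the coefficient along to the longer path, while the cocycle touches trivial
    paths only. *)
Lemma splitting_coef_path q m :
  (F (pend q) (act_path m q))@_q = (F (pstart q) m)@_(triv_path (pstart q)).
Proof.
elim/path_rect_last: q => [v|q a e IH]; first by rewrite F_idem.
rewrite act_path_cat pend_cat -[pend _]/(qt a) F_arrow mcoeffB mcoeffZ.
by rewrite coef_idem_cat mulr0 subr0 coef_mul_arr_cat -[qs a]e IH.
Qed.

(** By [F_idem], [F v] depends only on the finite dimensional component at [v]; the finite supports
    of its values on a basis bound all lengths. *)
Lemma splitting_coef_bound v :
  exists n, forall m q, (F v m)@_q != 0 -> (size (parrows q) < n)%N.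
Proof.
pose b (i : 'I_(\dim {:rsp X v})) := F v (single (vbasis {:rsp X v})`_i).
pose N i := (\max_(q <- msupp (b i)) size (parrows q))%N.
exists (\max_i N i).+1 => m q; rewrite ltnS leqNgt; apply: contra => lt.
rewrite -F_idem /act_idem (coord_vbasis (memvf (dfun m v))).
rewrite (lin_sum (@single_lin _ _ X v)) (lin_sum (@F_lin v)) raddf_sum big1 //= => i _.
rewrite (linZ (@single_lin _ _ X v)) (linZ (@F_lin v)) mcoeffZ -/(b i).
rewrite mcoeff_outdom ?mulr0 //; apply: contraL lt => qb.
rewrite -leqNgt; apply: leq_trans (leq_bigmax i).
exact: (@leq_bigmax_seq _ _ xpredT (fun q => size (parrows q))).
Qed.

End Splitting.

(** Indices in [nat], with value 0 beyond the dimension, serve all the spaces at once, zero spaces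
    included. *)
Definition nat_coord (V : vectType K) (j : nat) (x : V) : K :=
  if insub j is Some k then coord (vbasis {:V}) k x else 0.

Lemma nat_coord_lin (V : vectType K) j : linear (@nat_coord V j : V -> K^o).
Proof.
move=> c x y; rewrite /nat_coord; case: insubP => [k _ _|_]; first by rewrite linearP.
by rewrite scaler0 addr0.
Qed.

Lemma nat_coord_eq0 (V : vectType K) (x : V) :
  (forall j, nat_coord j x = 0) -> x = 0.
Proof.
move=> x0; rewrite (coord_vbasis (memvf x)) big1 // => k _.
by have := x0 k; rewrite /nat_coord valK => ->; rewrite scale0r.
Qed.

(* Read off the coefficient of the trivial path at [qt b] in a splitting. *)
Lemma arrows_jointly_injective (L : seq (Q1 Q * dsum X)) :
  \sum_(i <- L) act_arrow i.2 i.1 = 0 ->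
  forall b, \sum_(i <- L | i.1 == b) dfun i.2 (qs b) = 0.
Proof.
move=> L0 b; apply: nat_coord_eq0 => j.
(* A cocycle supported on the arrow [b] alone isolates the entries of [L] at [b]. *)
pose phi a (x : rsp X (qs a)) : K := if a == b then nat_coord j x else 0.
have phi_lin a : linear (@phi a : rsp X (qs a) -> K^o).
  move=> c x y; rewrite /phi; case: eqP => _; last by rewrite scaler0 addr0.
  exact: nat_coord_lin.
have [F [F_lin F_idem F_arrow]] := ext1_splitting phi_lin ext1.
have := congr1 (mcoeff (triv_path (qt b)) \o F (qt b)) L0.
rewrite /= (lin0 (F_lin _)) mcoeff0 (lin_sum (F_lin _)) raddf_sum /=.
under eq_bigr => i _ do rewrite (splitting_coef_triv F_lin F_idem F_arrow).
rewrite (lin_sum (@nat_coord_lin _ j)) [X in _ -> X = 0]big_mkcond /=.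
move=> s0; apply/eqP; rewrite -oppr_eq0 -sumrN; apply/eqP.
rewrite -[RHS]s0; apply: eq_bigr => -[a m] _ /=; rewrite /phi.
case: (eqVneq a b) => [->|_]; first by rewrite eqxx.
by rewrite oppr0 if_same.
Qed.

Definition pred_rel (u v : Q0 Q) : Prop :=
  exists a : Q1 Q, [/\ qs a = u, qt a = v & exists x : rsp X (qs a), x != 0].

(* A path [q] into [v] whose source has a predecessor carrying a nonzero
   space occurs in a splitting at [v], so finite dimensionality bounds its length. *)
Lemma pred_rel_wf : well_founded pred_rel.
Proof.
(* The coordinate [j a] is a nonzero linear form whenever the source space is nonzero, so one
   cocycle detects all such arrows. *)
have /choice [j jP] (a : Q1 Q) : exists j,
    (exists x : rsp X (qs a), x != 0) -> exists x : rsp X (qs a), nat_coord j x != 0.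
  have [[x xn0]|n] := pselect (exists x : rsp X (qs a), x != 0); last by exists 0%N.
  have [j jx] : exists j, nat_coord j x != 0.
    apply/not_existsP => H; case/eqP: xn0; apply: nat_coord_eq0 => j.
    by apply/eqP; apply/negPn/negP; exact: H.
  by exists j => _; exists x.
pose phi a (x : rsp X (qs a)) : K := nat_coord (j a) x.
have phi_lin a : linear (@phi a : rsp X (qs a) -> K^o) by exact: nat_coord_lin.
have [F [F_lin F_idem F_arrow]] := ext1_splitting phi_lin ext1.
have bound v : exists n, forall q, pend q = v ->
    (exists u, pred_rel u (pstart q)) -> (size (parrows q) < n)%N.
  have [n nP] := splitting_coef_bound F_lin F_idem v.
  exists n => q qv [u [a [_ at_ /jP [x xn0]]]].
  apply: (nP (act_path (act_arrow (single x) a) q)).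
  rewrite -qv (splitting_coef_path F_idem F_arrow) -at_.
  by rewrite (splitting_coef_triv F_lin F_idem F_arrow) eqxx oppr_eq0 single_eq.
(* Induction on the bound. A path into a predecessor of [v] becomes one arrow longer as a path into
   [v], so the bound drops by one; at bound 0 the trivial path at [v] excludes predecessors. *)
suff acc n : forall v, (forall q, pend q = v ->
    (exists u, pred_rel u (pstart q)) -> (size (parrows q) < n)%N) ->
    Acc pred_rel v.
  by move=> v; have [n /acc] := bound v.
elim: n => [|n IH] v vP; constructor => u uv.
  by have := vP (triv_path v) erefl (ex_intro _ u uv).
apply: IH => q qu qP; case: (uv) => a [au av _].
have e : pend q = pstart (arr a) by rewrite /= au.
have := vP (pcat e); rewrite pend_cat => /(_ av qP) /=.
by rewrite size_cat addn1.
Qed.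

End ExtVanishing.

(** * Splitting epimorphisms onto the module of a representation *)

(** Both sums equal the sum over the entries common to [s] and [t]. *)
Lemma sum_uniq_supp (V : zmodType) (T : eqType) (s t : seq T) (h : T -> V) :
  uniq s -> uniq t -> (forall u, u \notin s -> h u = 0) ->
  (forall u, u \notin t -> h u = 0) -> \sum_(u <- s) h u = \sum_(u <- t) h u.
Proof.
move=> us ut hs ht.
have half r r' : uniq r' -> (forall u, u \notin r' -> h u = 0) ->
    \sum_(u <- r) h u = \sum_(u <- [seq u <- r | u \in r']) h u.
  move=> ur' hr'; rewrite big_filter [RHS]big_mkcond; apply: eq_bigr => u _.
  by case: ifPn => // /hr'.
rewrite (half s t) // (half t s) //; apply: perm_big.
apply: uniq_perm; rewrite ?filter_uniq // => u.
by rewrite !mem_filter andbC.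
Qed.

Section Lifting.
Variables (K : fieldType) (Q : quiver) (X : rep K Q).
Hypothesis ext1 : Ext_zero (G X) (KQreg K Q) 1.
Variables (N : KQmodule K Q) (f : mcar N -> mcar (G X)).
Hypotheses (mN : is_module N) (hf : is_hom f) (f_surj : forall y, exists z, f z = y).

Let pN := module_premodule mN.
Let lf := hom_linear hf.
Let GA := G_arrow_action X.

Definition local_lift (v : Q0 Q) (h : rsp X v -> mcar N) : Prop :=
  [/\ linear h, forall x, f (h x) = single x
    & forall x, mact (h x) (idem K v) = h x].

(** Stating [y = rmap X a x] inside [dsum X], through [single] and [act_arrow], avoids a transport
    along [qt a = v]. *)
Definition local_compat (v : Q0 Q) (prev : forall u, rsp X u -> mcar N)
    (h : rsp X v -> mcar N) : Prop :=
  forall a m (y : rsp X v), qt a = v -> single y = act_arrow m a ->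
    h y = mact (@prev (qs a) (dfun m (qs a))) (bpath K (arr a)).

Lemma pred_relN a (x : rsp X (qs a)) : ~ pred_rel X (qs a) (qt a) -> x = 0.
Proof.
move=> n; apply/eqP/negPn/negP => xn0.
by case: n; exists a; split=> //; exists x.
Qed.

Lemma local_lift_exists v (prev : forall u, rsp X u -> mcar N) :
  (forall u, pred_rel X u v -> local_lift (@prev u)) ->
  (forall u, ~ pred_rel X u v -> @prev u = (fun=> 0)) ->
  exists h : rsp X v -> mcar N, local_lift h /\ local_compat prev h.
Proof.
move=> prevG prev0.
have lprev u : linear (@prev u).
  have [/prevG []//|/prev0 ->] := pselect (pred_rel X u v).
  exact: linear_zero.
(* This also holds at the default value 0, since then the source space of [a] is zero. *)
have fprev a x : qt a = v -> f (@prev (qs a) x) = single x.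
  move=> av; have [/prevG []//|n] := pselect (pred_rel X (qs a) v).
  rewrite -av in n; rewrite (pred_relN x n) (lin0 (lprev _)) (lin0 lf).
  by rewrite (lin0 (@single_lin _ _ X _)).
pose term (i : Q1 Q * dsum X) : mcar N :=
  mact (@prev (qs i.1) (dfun i.2 (qs i.1))) (bpath K (arr i.1)).
(* [A] collects the values forced on sums of images of arrow maps, [C] the conditions for a lift.
   Lists may repeat arrows, so concatenation gives additivity. *)
pose A (y : rsp X v) (w : mcar N) := exists L : seq (Q1 Q * dsum X),
  [/\ all (fun i => qt i.1 == v) L, single y = \sum_(i <- L) act_arrow i.2 i.1
    & w = \sum_(i <- L) term i].
pose C (y : rsp X v) (w : mcar N) := f w = single y /\ mact w (idem K v) = w.
have lC : linrel C.
  split.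
    split; last exact: (lin0 (act_linl pN _)).
    by rewrite (lin0 lf) (lin0 (@single_lin _ _ X _)).
  move=> c x y x' y' [e1 e2] [e3 e4]; split; first by rewrite lf e1 e3 single_lin.
  by rewrite (act_linl pN) e2 e4.
have lA : linrel A.
  split; first by exists [::]; rewrite !big_nil (lin0 (@single_lin _ _ X _)).
  move=> c x y x' y' [L [Lv Ly Lw]] [L' [Lv' Ly' Lw']].
  exists ([seq (i.1, c *: i.2) | i <- L] ++ L'); split.
  - by rewrite all_cat all_map Lv'; apply/andP; split.
  - rewrite big_cat big_map /= single_lin Ly Ly' scaler_sumr; congr (_ + _).
    by apply: eq_bigr => i _; rewrite (linZ (al_lin GA _)).
  - rewrite big_cat big_map /= Lw Lw' scaler_sumr; congr (_ + _).
    apply: eq_bigr => i _; rewrite /term /= (linZ (@dfun_lin _ _ X _)).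
    by rewrite (linZ (lprev _)) (linZ (act_linl pN _)).
have fA : functional_rel A.
  move=> w [L [_ L0 ->]]; move: L0; rewrite (lin0 (@single_lin _ _ X _)).
  move/esym => L0; have inj := arrows_jointly_injective ext1 L0.
  (* Regrouped by arrow, the arguments at each [b] add up to 0 by [inj], hence so do the terms. *)
  have -> : \sum_(i <- L) term i = \sum_(i <- L)
      \sum_(b <- undup [seq i.1 | i <- L] | i.1 == b) term i.
    rewrite !big_seq; apply: eq_bigr => i iL; rewrite big_mkcond /=.
    rewrite (@sum_uniq_delta _ _ _ i.1) ?undup_uniq ?mem_undup ?map_f ?eqxx //.
    by move=> u nu; rewrite eq_sym (negPf nu).
  rewrite (exchange_big_dep xpredT) //= big1 // => b _.
  rewrite (eq_bigr (fun i => mact (@prev (qs b) (dfun i.2 (qs b))) (bpath K (arr b)))).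
    rewrite -(lin_sum (act_linl pN _)) -(lin_sum (lprev _)) inj.
    by rewrite (lin0 (lprev _)) (lin0 (act_linl pN _)).
  by move=> i /eqP <-.
have AC x y : A x y -> C x y.
  move=> [L [/allP Lv Ly ->]]; split.
    rewrite (lin_sum lf) Ly !big_seq; apply: eq_bigr => i /Lv /eqP iv.
    by rewrite (hom_act _ _ hf) (fprev _ _ iv) act_path_arr (al_ev GA).
  rewrite (lin_sum (act_linl pN _)) !big_seq; apply: eq_bigr => i /Lv /eqP iv.
  by rewrite (actA pN) mul_idem.
(* Any preimage of [single x], cut down by the idempotent at [v], will do. *)
have Ct x : exists y, C x y.
  have [z fz] := f_surj (single x); exists (mact z (idem K v)); split.
    by rewrite (hom_act _ _ hf) fz act_path_idem /act_idem single_eq.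
  exact: act_triv.
have [h [lh hC hA]] := linrel_extend lA lC fA AC Ct.
exists h; split; first by split=> // x; case: (hC x).
move=> a m y av ym; apply: hA; exists [:: (a, m)]; split=> /=.
- by rewrite av eqxx.
- by rewrite big_seq1.
- by rewrite big_seq1.
Qed.

Lemma compatible_lifts : exists g : forall v, rsp X v -> mcar N,
  (forall v, local_lift (@g v)) /\
  forall a x, g (qt a) (rmap X a x) = mact (g (qs a) x) (bpath K (arr a)).
Proof.
have [g gP] := wf_choice (T := fun v => rsp X v -> mcar N) (d := fun v _ => 0)
  (pred_rel_wf ext1) local_lift_exists.
exists g; split=> [v|a x]; first by case: (gP v).
have [_ /(_ a (single x) (rmap X a x) erefl)] := gP (qt a).
rewrite /act_arrow single_eq => /(_ erefl) ->.
(* Where the default replaces [g], the source space is zero and both sides vanish. *)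
case: pselect => // n; rewrite (pred_relN x n).
by have [[lg _ _] _] := gP (qs a); rewrite (lin0 lg).
Qed.

Lemma dsum_linear_ext (W : lmodType K) (h k : dsum X -> W) :
  linear h -> linear k -> (forall v (x : rsp X v), h (single x) = k (single x)) ->
  h =1 k.
Proof.
move=> lh lk e m; have [s us sP] := dsum_supp m.
rewrite (dsum_decomp us sP) (lin_sum lh) (lin_sum lk).
by apply: eq_bigr => v _; rewrite e.
Qed.

(** * Gluing the local lifts into a section *)

Section Glue.
Variable g : forall v, rsp X v -> mcar N.
Hypothesis g_lift : forall v, local_lift (@g v).

Let lg v : linear (@g v). Proof. by case: (g_lift v). Qed.

(** The support list is an arbitrary choice; [glueE] shows that the sum does not depend on it. *)
Definition glue (m : dsum X) : mcar N :=
  \sum_(v <- s2val (cid2 (dsum_supp m))) g (dfun m v).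

Lemma glueE m (s : seq (Q0 Q)) : uniq s -> (forall v, v \notin s -> dfun m v = 0) ->
  glue m = \sum_(v <- s) g (dfun m v).
Proof.
move=> us sP; rewrite /glue; case: cid2 => t ut tP /=.
by apply: sum_uniq_supp => // v => [/tP|/sP] ->; rewrite (lin0 (@lg v)).
Qed.

Lemma glue_single v (x : rsp X v) : glue (single x) = g x.
Proof.
rewrite (@glueE _ [:: v]) ?big_seq1 ?single_eq // => w.
by rewrite inE => /eqP ne; rewrite single_neq // => e; case: ne.
Qed.

Lemma glue_lin : linear glue.
Proof.
move=> c m n; have [s us sP] := dsum_supp m; have [t ut tP] := dsum_supp n.
pose r := undup (s ++ t).
have rP v : v \notin r -> dfun m v = 0 /\ dfun n v = 0.
  by rewrite mem_undup mem_cat negb_or => /andP[/sP ? /tP ?].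
have ur : uniq r by exact: undup_uniq.
rewrite !(@glueE _ r) // => [|v /rP []|v /rP []|v /rP [e1 e2]] //; last first.
  by rewrite dfun_lin e1 e2 scaler0 addr0.
rewrite scaler_sumr -big_split; apply: eq_bigr => v _ /=.
by rewrite dfun_lin lg.
Qed.

Lemma glue_section m : f (glue m) = m.
Proof.
move: m; apply: dsum_linear_ext => [|//|v x]; first exact: linear_comp lf glue_lin.
by rewrite glue_single; case: (g_lift v).
Qed.

Hypothesis g_arrow :
  forall a x, g (rmap X a x) = mact (@g (qs a) x) (bpath K (arr a)).

Lemma glue_idem m v : glue (act_idem m v) = mact (glue m) (idem K v).
Proof.
move: m; apply: dsum_linear_ext => [c m n|c m n|w x].
- by rewrite (ev_lin GA) glue_lin.
- by rewrite glue_lin (act_linl pN).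
have [_ _ gw] := g_lift w; rewrite glue_single -[g x]gw (actA pN) idem_idem.
case: eqP => [e|ne]; first by subst w; rewrite /act_idem single_eq glue_single gw.
rewrite /act_idem single_neq // (lin0 (@single_lin _ _ X _)) (lin0 glue_lin).
by rewrite (lin0 (act_linr pN _)).
Qed.

Lemma glue_arrow m a : glue (act_arrow m a) = mact (glue m) (bpath K (arr a)).
Proof.
move: m; apply: dsum_linear_ext => [c m n|c m n|w x].
- by rewrite (al_lin GA) glue_lin.
- by rewrite glue_lin (act_linl pN).
have [e|ne] := pselect (w = qs a).
  by subst w; rewrite /act_arrow single_eq !glue_single g_arrow.
have [_ _ gw] := g_lift w; rewrite glue_single -[g x]gw (actA pN) KQmulU pmul_neq //.
rewrite /act_arrow single_neq // linear0 (lin0 (@single_lin _ _ X _)).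
by rewrite (lin0 glue_lin) (lin0 (act_linr pN _)).
Qed.

Lemma glue_hom : is_hom (glue : mcar (G X) -> mcar N).
Proof.
split; [exact: linD glue_lin | exact: linZ glue_lin | move=> m x].
move: x; apply: malg_linear_ext => [c x y|c x y|p].
- by rewrite (act_linr (G_premodule X)) glue_lin.
- exact: (act_linr pN).
rewrite /= /Gact -/(mlift _ _) mliftU.
elim/path_rect_last: p => [v|p a e IH]; first exact: glue_idem.
rewrite act_path_cat glue_arrow IH (actA pN).
by rewrite -/(bpath K p) KQmulU (pmul_cat _ e).
Qed.

End Glue.

Lemma lifting_splits : exists g : mcar (G X) -> mcar N,
  is_hom g /\ forall y, f (g y) = y.
Proof.
have [g [g_lift g_arrow]] := compatible_lifts.
by exists (glue g); split; [exact: glue_hom | exact: glue_section].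
Qed.

End Lifting.

Theorem theorem1p11 (K : closedFieldType) (Q : quiver) :
  connected Q ->
  (forall P0' : seq (Q0 Q),
     finite_quiver (quiver_closure P0') /\ acyclic (quiver_closure P0')) ->
  forall X : rep K Q,
    (forall n : nat, (1 <= n)%N -> Ext_zero (G X) (KQreg K Q) n) ->
    projective (G X).
Proof.
move=> _ _ X ext N mN f hf f_surj.
exact: (lifting_splits (ext 1%N isT) mN hf f_surj).
Qed.
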